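(* Let $E$ be a set of $n$ points in $\mathbb{R}^3$ and let $m\ge 2$. The number of tuples $(x_1,x_2,x_3,x_4)\in E^4$ with $\angle(x_1,x_2,x_3)=\angle(x_2,x_3,x_4)=\pi/2$ such that the line through $x_2,x_3$ contains at least $m$ points of $E$ and the lines through $x_1,x_2$ and through $x_3,x_4$ are not parallel, is $$\lesssim \frac{n^4}{m^3}+\frac{n^3}{m}.$$
   Context: $\angle(x,y,z)\in[0,\pi]$ denotes the angle at $y$ between $x-y$ and $z-y$ (for $x\ne y\ne z$). $X\lesssim Y$ means $X\le CY$ for all $n>N$ with constants $C,N$ independent of $n,m$. *)

(* Defs.v *)
From HB Require Import structures.
From mathcomp Require Import all_boot all_order all_algebra finmap.
From mathcomp Require Import all_classical all_reals all_analysis.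

Set Implicit Arguments.
Unset Strict Implicit.
Unset Printing Implicit Defensive.

Import Order.TTheory GRing.Theory Num.Theory.

Local Open Scope classical_set_scope.
Local Open Scope fset_scope.
Local Open Scope ring_scope.

Section Geometry.
Variables (R : realType) (d : nat).
Implicit Types (x y z p : 'rV[R]_d) (L M : set 'rV[R]_d) (E : {fset 'rV[R]_d}).

Definition dot x y : R := \sum_(i < d) x 0 i * y 0 i.

(* The library norm on matrices is the sup norm, hence this separate one. *)
Definition enorm x : R := Num.sqrt (dot x x).

(* Meaningful only for x != y and y != z: otherwise the quotient is 0 and the
   value is the junk acos 0 = pi / 2. *)
Definition angle x y z : R :=
  acos (dot (x - y) (z - y) / (enorm (x - y) * enorm (z - y))).

Definition right_angle x y z : Prop :=
  [/\ x != y, y != z & angle x y z = pi / 2].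

Definition line x y : set 'rV[R]_d :=
  [set p | exists t : R, p = x + t *: (y - x)].

Definition parallel L M : Prop :=
  exists v : 'rV[R]_d, M = [set p + v | p in L].

Definition npoints_on E L : nat := #|` [fset p in E | p \in L]|.

(* A tuple is the left-nested quadruple (x1, x2, x3, x4). *)
Definition good_tuple E (m : nat)
    (t : 'rV[R]_d * 'rV[R]_d * 'rV[R]_d * 'rV[R]_d) : Prop :=
  let: (x1, x2, x3, x4) := t in
  [/\ right_angle x1 x2 x3, right_angle x2 x3 x4,
      (m <= npoints_on E (line x2 x3))%N
    & ~ parallel (line x1 x2) (line x3 x4)].

Definition good_tuples E (m : nat) :=
  [fset t in (E `*` E `*` E `*` E)%fset | `[< good_tuple E m t >]].

End Geometry.

(* Main.v *)
(** If (x1, x2, x3, x4) is counted and l is the line x2 x3, then x2 and x3 are the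
    feet of x1 and x4 on l, so each line carrying at least m points of E accounts
    for at most n^2 tuples.  It remains to bound the
    number of such lines by O(n^2 / m^3 + n / m), which is the Szemeredi-Trotter
    theorem.  After a generic projection to a plane we argue as Szekely: join
    consecutive points on the rich lines, and compare the number of edges with the
    number of crossings via the crossing lemma.

    The crossing lemma needs a linear bound on the edges of a plane straight-line
    graph.  Instead of Euler's formula we charge each edge e that is not the highest
    one at its left endpoint to the first vertex c met by a sweep to the right
    between e and the next higher edge g at that endpoint.  Knowing c and whether g
    ends at c determines e, so there are at most 3 |V| edges. *)

Require Import Defs.
From mathcomp Require Import all_boot all_order all_algebra finmap.
From mathcomp Require Import all_classical all_reals all_analysis.
From mathcomp Require Import ring lra zify.

Import Order.TTheory GRing.Theory Num.Theory.

Local Open Scope ring_scope.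

(** * Comparing cardinalities through a relation *)

Section Counting.
Set Implicit Arguments.
Unset Strict Implicit.

(** Choice turns [r] into an injection of [A] into [B], so a charging scheme can be given by
    existence and uniqueness proofs alone. *)
Lemma leq_card_rel (T T' : finType) (A : {set T}) (B : {set T'})
    (r : T -> T' -> Prop) :
    (forall a, a \in A -> exists2 b, b \in B & r a b) ->
    (forall a a' b, a \in A -> a' \in A -> r a b -> r a' b -> a = a') ->
  (#|A| <= #|B|)%N.
Proof.
move=> ex inj; have [->|[a0 Aa0]] := set_0Vmem A; first by rewrite cards0.
have [b0 _ _] := ex _ Aa0.
have /choice[f fP] : forall a, exists b, a \in A -> b \in B /\ r a b.
  move=> a; have [/ex[b Bb rab]|] := boolP (a \in A); first by exists b.
  by exists b0.
have f_inj : {in A &, injective f}.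
  move=> a a' Aa Aa' eqf; apply: (inj a a' (f a)) => //; first exact: (fP a Aa).2.
  by rewrite eqf; exact: (fP a' Aa').2.
rewrite -(card_in_imset f_inj); apply/subset_leq_card/fintype.subsetP =>
  _ /imsetP[a Aa ->].
exact: (fP a Aa).1.
Qed.

End Counting.

(** * Straight-line drawings: a linear edge bound and its version with crossings *)

Section PlaneDrawing.
Set Implicit Arguments.
Unset Strict Implicit.
Variables (R : realType) (V : finType) (X Y : V -> R).
Implicit Types (e g h : V * V) (s t : R) (G : {set V * V}) (U : {set V}).

Definition slope e : R := (Y e.2 - Y e.1) / (X e.2 - X e.1).
Definition intercept e : R := Y e.1 - slope e * X e.1.
(** In a drawing the left endpoint of [e] comes first, and [e] is the graph of this affine function
    between the abscissas of its ends. *)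
Definition height e t : R := intercept e + slope e * t.

Lemma height_left e : height e (X e.1) = Y e.1.
Proof. by rewrite /height /intercept; ring. Qed.

Lemma height_right e : X e.1 < X e.2 -> height e (X e.2) = Y e.2.
Proof.
move=> lt12; have ne : X e.2 - X e.1 != 0 by lra.
by rewrite /height /intercept /slope; field.
Qed.

(** Strictness keeps a shared endpoint from being a crossing, while distinct collinear edges that
    overlap do cross. *)
Definition crosses_at g h t :=
  [/\ X g.1 < t, t < X g.2, X h.1 < t, t < X h.2 & height g t = height h t].

Definition crossing g h : bool := (g != h) && `[< exists t, crosses_at g h t >].

Lemma affine_root (a b s t : R) : a + b * s < 0 -> 0 < a + b * t ->
  exists2 u, a + b * u = 0 & (s < u < t) || (t < u < s).
Proof.
move=> neg pos; have b0 : b != 0 by apply: contraTneq pos => b0; move: neg; rewrite b0;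
  lra.
exists (- a / b); first by field.
have e : a = - (- a / b * b) by field.
move: neg pos; set u := - a / b in e *; rewrite e.
have [bp|bn|/eqP] := ltgtP 0 b; last by rewrite eq_sym (negPf b0).
- move=> neg pos; apply/orP; left; apply/andP; split;
  rewrite -subr_gt0 -(pmulr_rgt0 _ bp); lra.
- move=> neg pos; apply/orP; right; apply/andP; split;
  rewrite -subr_gt0 -(nmulr_rlt0 _ bn); lra.
Qed.

(** If the order switched, the difference of the two affine functions would vanish strictly between
    [s] and [t], hence inside both edges. The conclusion is weak because the edges may meet at an
    end. *)
Lemma height_le g h s t : ~~ crossing g h ->
    X g.1 <= s <= X g.2 -> X h.1 <= s <= X h.2 ->
    X g.1 <= t <= X g.2 -> X h.1 <= t <= X h.2 ->
  height g s < height h s -> height g t <= height h t.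
Proof.
move=> ncr gs hs gt ht lts; rewrite leNgt; apply: contra ncr => ltt.
have [||u eu ru] := @affine_root (intercept g - intercept h) (slope g - slope h) s t.
- by move: lts; rewrite /height; lra.
- by move: ltt; rewrite /height; lra.
apply/andP; split; first by apply: contraTneq lts => ->; rewrite ltxx.
apply/asboolP; exists u; case/orP: ru => ru; split; rewrite ?/height; lra.
Qed.

Definition drawing G := forall e, e \in G ->
  X e.1 < X e.2 /\ forall c, X e.1 < X c < X e.2 -> Y c <> height e (X c).

Definition planar G := forall g h, g \in G -> h \in G -> ~~ crossing g h.

Definition spans G U := forall e, e \in G -> e.1 \in U /\ e.2 \in U.

Hypothesis X_inj : injective X.

(** Otherwise the shorter of the two edges would end inside the longer one, which a drawing
    forbids. *)
Lemma slope_inj_left G e g : drawing G -> e \in G -> g \in G ->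
  e.1 = g.1 -> slope e = slope g -> e = g.
Proof.
have key e' g' : drawing G -> e' \in G -> g' \in G ->
    e'.1 = g'.1 -> slope e' = slope g' -> ~ X e'.2 < X g'.2.
  move=> dG Ge Gg e1 es lt2; have [e12 _] := dG _ Ge; have [g12 gn] := dG _ Gg.
  apply: (gn e'.2); first by rewrite -e1 e12.
  by rewrite -(height_right e12) /height /intercept es e1.
move=> dG Ge Gg e1 es; have [lt|lt|/X_inj] := ltgtP (X e.2) (X g.2).
- by case: (key e g).
- by case: (key g e).
by case: e g e1 {es Ge Gg} => ? ? [? ?] /= -> ->.
Qed.

Lemma slope_inj_right G e g : drawing G -> e \in G -> g \in G ->
  e.2 = g.2 -> slope e = slope g -> e = g.
Proof.
have key e' g' : drawing G -> e' \in G -> g' \in G ->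
    e'.2 = g'.2 -> slope e' = slope g' -> ~ X g'.1 < X e'.1.
  move=> dG Ge Gg e1 es lt2; have [e12 _] := dG _ Ge; have [g12 gn] := dG _ Gg.
  apply: (gn e'.1); first by rewrite -e1 lt2.
  have := height_right g12; have := height_right e12.
  by rewrite -(height_left e') /height es e1; lra.
move=> dG Ge Gg e1 es; have [lt|lt|/X_inj] := ltgtP (X g.1) (X e.1).
- by case: (key e g).
- by case: (key g e).
by case: e g e1 {es Ge Gg} => ? ? [? ?] /= -> ->.
Qed.

Definition next_above G e g :=
  [/\ g \in G, g.1 = e.1, slope e < slope g &
      forall h, h \in G -> h.1 = e.1 -> slope e < slope h -> slope g <= slope h].

(** The region between [e] and [g] up to the nearer of their right ends. It omits the apex but
    contains that right end, which is thus a candidate for the tip. *)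
Definition in_wedge e g c :=
  [&& X e.1 < X c, X c <= X e.2, X c <= X g.2 &
      height e (X c) <= Y c <= height g (X c)].

Definition wedge_tip G U e g c :=
  [/\ c \in U, in_wedge e g c & forall b, b \in U -> in_wedge e g b -> X c <= X b].

Lemma height_common_left e g t : g.1 = e.1 ->
  height g t - height e t = (slope g - slope e) * (t - X e.1).
Proof. by move=> e1; rewrite /height /intercept e1; ring. Qed.

(** The nearer right end of [e] and [g] lies in the wedge, so a leftmost vertex there exists. *)
Lemma wedge_tip_exists G U e g : drawing G -> spans G U -> e \in G ->
  next_above G e g -> exists c, wedge_tip G U e g c.
Proof.
move=> dG sG Ge [Gg e1 lts _]; have [e12 _] := dG _ Ge; have [g12 _] := dG _ Gg.
have [_ Ue] := sG _ Ge; have [_ Ug] := sG _ Gg.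
have le t : X e.1 <= t -> height e t <= height g t.
  by move=> le1; rewrite -subr_ge0 (height_common_left _ e1) mulr_ge0 ?subr_ge0 // ltW.
have [c0 Pc0] : exists c0, (c0 \in U) && in_wedge e g c0.
  have [le2|lt2] := leP (X e.2) (X g.2).
    exists e.2;
      rewrite Ue /in_wedge e12 lexx le2 (height_right e12) lexx /= -(height_right e12).
    exact/le/ltW.
  exists g.2;
    rewrite Ug /in_wedge -e1 g12 lexx (ltW lt2) (height_right g12) lexx /= andbT
      -(height_right g12).
  by apply: le; rewrite -e1 ltW.
case: (@arg_minP _ _ _ c0 (fun b => (b \in U) && in_wedge e g b) X Pc0) =>
  c /andP[Uc Wc] minc; exists c; split=> // b Ub Wb.
by apply: minc; rewrite Ub.
Qed.

(** An edge starting left of the apex passes above or below it and, without crossings, stays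
    outside. One starting inside the wedge would give a vertex before [c]. One starting at the apex
    would have a slope between those of [e] and [g]. *)
Lemma wedge_empty G U e g c h t : drawing G -> planar G -> spans G U ->
    e \in G -> next_above G e g -> wedge_tip G U e g c -> h \in G ->
    X h.1 < t < X h.2 -> X e.1 < t < X c ->
  height e t < height h t -> ~ height h t < height g t.
Proof.
move=> dG pG sG Ge [Gg e1 lts ming] [Uc /and4P[ec ce cg Wc] minc] Gh ht et lteh lthg.
have [h12 hn] := dG _ Gh; have [g12 _] := dG _ Gg; have [e12 _] := dG _ Ge.
have [hle|hge|/X_inj h1] := ltgtP (X h.1) (X e.1).
- have /hn Ye : X h.1 < X e.1 < X h.2 by lra.
  have [lt|lt|//] := ltgtP (Y e.1) (height h (X e.1)).
    have: height g t <= height h t; last by lra.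
    apply: (@height_le g h (X e.1)); rewrite ?e1 ?pG //; try lra.
    by rewrite -{1}e1 height_left e1.
  have: height h t <= height e t; last by lra.
  by apply: (@height_le h e (X e.1)); rewrite ?pG ?height_left //; lra.
- have hl := height_left h.
  have Xeg : X g.1 = X e.1 by rewrite e1.
  have [lt|ge] := ltP (Y h.1) (height e (X h.1)).
    have: height h t <= height e t; last by lra.
    by apply: (@height_le h e (X h.1)); rewrite ?pG //; lra.
  have [lt|le] := ltP (height g (X h.1)) (Y h.1).
    have: height g t <= height h t; last by lra.
    by apply: (@height_le g h (X h.1)); rewrite ?pG //; lra.
  have [Uh _] := sG _ Gh.
  have: X c <= X h.1; last by lra.
  by apply: minc => //; rewrite /in_wedge hge ge le /= andbT; apply/andP; split; lra.
- have := height_common_left t h1; have := height_common_left t e1.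
  have tp : 0 < t - X e.1 by lra.
  move=> eg eh.
  have seh : slope e < slope h.
    by rewrite -subr_gt0 -(pmulr_lgt0 _ tp) -eh subr_gt0.
  have shg : slope h < slope g.
    rewrite -subr_gt0 -(pmulr_lgt0 _ tp).
    have -> : (slope g - slope h) * (t - X e.1) = height g t - height h t by lra.
    by rewrite subr_gt0.
  by have := ming _ Gh h1 seh; lra.
Qed.

(* Just left of a tip [c] the wedges with tip [c] are stacked, so of two such
   wedges the lower one ends at [c] with its upper edge and the upper one with
   its lower edge. *)
Lemma wedge_tip_inj_aux G U e1 g1 e2 g2 c t : drawing G -> planar G -> spans G U ->
    e1 \in G -> e2 \in G -> next_above G e1 g1 -> next_above G e2 g2 ->
    wedge_tip G U e1 g1 c -> wedge_tip G U e2 g2 c ->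
    X e1.1 < t < X c -> X e2.1 < t < X c ->
  height e1 t < height e2 t -> g1.2 = c /\ g2.2 != c.
Proof.
move=> dG pG sG G1 G2 N1 N2 W1 W2 t1 t2 lt12.
have [Gg1 h1 _ _] := N1; have [Gg2 h2 lts2 _] := N2.
have [_ /and4P[c1 c1e c1g /andP[Y1 Y1']] _] := W1.
have [_ /and4P[c2 c2e c2g /andP[Y2 Y2']] _] := W2.
have Xg1 : X g1.1 = X e1.1 by rewrite h1.
(* The edge [e2] runs above [e1] at [t], so the emptiness of the first wedge puts it no lower than
   [g1]. *)
have lege : height g1 t <= height e2 t.
  rewrite leNgt; apply/negP; apply: (wedge_empty dG pG sG G1 N1 W1 G2) => //; lra.
have legec : height g1 (X c) <= height e2 (X c).
  have [->//|ne] := eqVneq g1 e2.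
  apply: (@height_le g1 e2 t); rewrite ?pG //; try lra.
  rewrite lt_neqAle lege andbT; apply: contra (pG _ _ Gg1 G2) => /eqP eqt.
  by rewrite /crossing ne /=; apply/asboolP; exists t; split; lra.
(* At [X c] the heights of [g1] and [e2] both equal [Y c]; as no vertex lies inside an edge, [c] is
   the right end of both. *)
have [g12 gn] := dG _ Gg1; have [e12 en] := dG _ G2.
have gc : g1.2 = c.
  apply: X_inj; apply/eqP; rewrite eq_le c1g andbT leNgt; apply/negP => lt.
  by apply: (gn c); lra.
have ec : e2.2 = c.
  apply: X_inj; apply/eqP; rewrite eq_le c2e andbT leNgt; apply/negP => lt.
  by apply: (en c); lra.
split=> //; apply: contraTneq lts2 => g2c.
suff -> : e2 = g2 by rewrite ltxx.
by case: e2 g2 h2 ec g2c {G2 N2 W2 t2 lt12 Gg2 Y2 Y2' c2 c2e c2g lege legec e12 en} =>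
  ? ? [? ?] /= -> -> ->.
Qed.

Lemma wedge_tip_inj G U e1 g1 e2 g2 c : drawing G -> planar G -> spans G U ->
    e1 \in G -> e2 \in G -> next_above G e1 g1 -> next_above G e2 g2 ->
    wedge_tip G U e1 g1 c -> wedge_tip G U e2 g2 c ->
  (g1.2 == c) = (g2.2 == c) -> e1 = e2.
Proof.
move=> dG pG sG G1 G2 N1 N2 W1 W2 eqb; apply/eqP; apply/negPn/negP => ne.
have [_ /and4P[c1 c1e _ _] _] := W1.
have [_ /and4P[c2 c2e _ _] _] := W2.
(* An abscissa right of both apexes and left of [c]; equal heights there would be a crossing. *)
pose t := (Num.max (X e1.1) (X e2.1) + X c) / 2.
have [t1 t2] : X e1.1 < t < X c /\ X e2.1 < t < X c.
  by rewrite /t; case: (leP (X e1.1) (X e2.1)) => ?; split; apply/andP; split; lra.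
have [lt|lt|eqt] := ltgtP (height e1 t) (height e2 t).
- have [/eqP e ne'] := wedge_tip_inj_aux dG pG sG G1 G2 N1 N2 W1 W2 t1 t2 lt.
  by move: ne'; rewrite -eqb e.
- have [/eqP e ne'] := wedge_tip_inj_aux dG pG sG G2 G1 N2 N1 W2 W1 t2 t1 lt.
  by move: ne'; rewrite eqb e.
have /negP[] := pG _ _ G1 G2.
by rewrite /crossing ne /=; apply/asboolP; exists t; split; lra.
Qed.

Lemma planar_card G U : drawing G -> planar G -> spans G U -> (#|G| <= 3 * #|U|)%N.
Proof.
move=> dG pG sG.
pose low e := [exists g in G, (g.1 == e.1) && (slope e < slope g)].
(* Edges with a higher companion inject into pairs of a tip and a bit; the highest edges inject into
   their left endpoints. *)
rewrite -(cardsID [set e | low e] G) (_ : 3 * #|U| = #|U| * 2 + #|U|)%N; last by lia.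
apply: leq_add.
  rewrite -card_bool -cardsT -cardsX.
  apply: (@leq_card_rel _ _ _ _ (fun e cb => exists g,
     [/\ next_above G e g, wedge_tip G U e g cb.1 & cb.2 = (g.2 == cb.1)])).
  - move=> e; rewrite !inE => /andP[Ge /exists_inP[g0 Gg0 /andP[/eqP g01 lt0]]].
    have [g Ng] : exists g, next_above G e g.
      have Pg0 : [&& g0 \in G, g0.1 == e.1 & slope e < slope g0] by rewrite Gg0 g01 eqxx.
      case: (@arg_minP _ _ _ g0 (fun g =>
        [&& g \in G, g.1 == e.1 & slope e < slope g]) slope Pg0) =>
          g /and3P[Gg /eqP g1 lt] ming; exists g; split=> // h Gh h1 lth.
      by apply: ming; rewrite Gh h1 eqxx.
    have [c Wc] := wedge_tip_exists dG sG Ge Ng.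
    exists (c, g.2 == c); last by exists g.
    by have [Uc _ _] := Wc; rewrite !inE Uc.
  - move=> e1 e2 [c b]; rewrite !inE =>
    /andP[G1 _] /andP[G2 _] [g1 /=[N1 W1 b1]] [g2 /=[N2 W2 b2]].
    by apply: (wedge_tip_inj dG pG sG G1 G2 N1 N2 W1 W2); rewrite -b1 -b2.
have inj : {in G :\: [set e | low e] &, injective (fun e => e.1)}.
  move=> e g; rewrite !inE => /andP[/exists_inPn le Ge] /andP[/exists_inPn lg Gg] /= e1.
  apply: (slope_inj_left dG) => //; apply/eqP; rewrite eq_le !leNgt.
  by have := le _ Gg; have := lg _ Ge; rewrite -e1 eqxx /= => -> ->.
rewrite -(card_in_imset inj); apply/subset_leq_card/fintype.subsetP => _ /imsetP[e + ->].
by rewrite !inE => /andP[_ /sG[]].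
Qed.

Definition crossings G : {set (V * V) * (V * V)} :=
  [set p | [&& p.1 \in G, p.2 \in G & crossing p.1 p.2]].

(** Deleting an edge that takes part in a crossing lowers both the edge count by one and the
    crossing count by at least one; induct until the drawing is planar. *)
Lemma drawing_card G U : drawing G -> spans G U ->
  (#|G| <= 3 * #|U| + #|crossings G|)%N.
Proof.
have [k] := ubnP #|G|; elim: k G => // k IHk G ltk dG sG.
have [p0|[[g h] gh]] := set_0Vmem (crossings G).
  rewrite p0 cards0 addn0; apply: planar_card => // g h Gg Gh.
  apply/negP => c; suff: (g, h) \in crossings G by rewrite p0 inE.
  by rewrite inE Gg Gh.
have /and3P[/= Gg Gh cgh] : [&& g \in G, h \in G & crossing g h] by rewrite inE in gh.
have cG := cardsD1 g G; rewrite Gg add1n in cG.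
have : (#|G :\ g| <= 3 * #|U| + #|crossings (G :\ g)|)%N.
  apply: IHk; first by rewrite -ltnS -cG.
    by move=> e; rewrite !inE => /andP[_]; exact: dG.
  by move=> e; rewrite !inE => /andP[_]; exact: sG.
have : (#|crossings (G :\ g)| <= #|crossings G :\ (g, h)|)%N.
  apply/subset_leq_card/fintype.subsetP => -[a b]; rewrite !inE /= =>
    /and3P[/andP[ag Ga] /andP[bg Gb] c].
  by rewrite Ga Gb c xpair_eqE (negPf ag).
have cC := cardsD1 (g, h) (crossings G); rewrite gh add1n in cC.
by rewrite cG cC addnS ltnS => le1 le2; apply: leq_trans le2 _; rewrite leq_add2l.
Qed.

End PlaneDrawing.

(** * Random vertex samples, expressed by counting *)

Section Sampling.
Set Implicit Arguments.
Unset Strict Implicit.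
Variable V : finType.

(** For uniform [f] this is a random sample containing each vertex independently with probability
    [1 / k.+1]. *)
Definition zeros k (f : {ffun V -> 'I_k.+1}) : {set V} := [set v | f v == ord0].

(** The probability that a sample contains [A], cleared of denominators: [f] is fixed on [A] and
    free elsewhere. *)
Lemma card_zeros_superset k (A : {set V}) :
  (#|[set f : {ffun V -> 'I_k.+1} | A \subset zeros f]| * k.+1 ^ #|A| = k.+1 ^ #|V|)%N.
Proof.
rewrite (_ : #|_| = #|pffun_on (@ord0 k) (~: A) predT|).
  by rewrite card_pffun_on card_ord -expnD addnC cardsC.
apply: eq_card => f; rewrite inE; apply/fintype.subsetP/pffun_onP => [sA|[sA _] v Av].
  split=> //; apply/fintype.subsetP => v; rewrite !inE; apply: contra => /sA;
    by rewrite inE.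
rewrite inE; apply/negPn/negP => fv.
by have /fintype.subsetP/(_ v fv) := sA; rewrite !inE Av.
Qed.

(** Linearity of expectation, as a double count of the pairs of [f] and [a]. *)
Lemma sum_card_zeros_superset k j (I : finType) (A : {set I}) (S : I -> {set V}) :
    (forall a, a \in A -> #|S a| = j) ->
  ((\sum_(f : {ffun V -> 'I_k.+1}) #|[set a in A | S a \subset zeros f]|) * k.+1 ^ j
    = #|A| * k.+1 ^ #|V|)%N.
Proof.
move=> cS; under eq_bigr => f _.
  rewrite -sum1_card; under eq_bigl => a do rewrite inE.
  rewrite big_mkcondr; over.
rewrite exchange_big big_distrl /= -sum_nat_const; apply: eq_bigr => a Aa.
rewrite -(card_zeros_superset k (S a)) cS // -big_mkcond sum1_card; congr (_ * _)%N.
by apply: eq_card => f; rewrite inE.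
Qed.

End Sampling.

(** * The crossing lemma by random sampling *)

Section CrossingLemma.
Set Implicit Arguments.
Unset Strict Implicit.
Variables (R : realType) (V : finType) (X Y : V -> R).
Hypothesis X_inj : injective X.
Implicit Types (G : {set V * V}) (e g h : V * V).

Lemma card_endpoints G e : drawing X Y G -> e \in G -> #|[set e.1; e.2]| = 2%N.
Proof.
move=> dG Ge; have [lt _] := dG _ Ge; rewrite cards2; case: eqVneq => // e12.
by move: lt; rewrite e12 ltxx.
Qed.

(** Crossing edges share no vertex: a common left or right end would force equal slopes, and the
    right end of one cannot be the left end of the other since their abscissas overlap. *)
Lemma card_crossing_endpoints G g h : drawing X Y G -> g \in G -> h \in G ->
  crossing X Y g h -> #|[set g.1; g.2] :|: [set h.1; h.2]| = 4%N.
Proof.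
move=> dG Gg Gh /andP[ne /asboolP[t [g1 g2 h1 h2 eqt]]].
suff d : [disjoint [set g.1; g.2] & [set h.1; h.2]].
  by apply/eqP; have := leq_card_setU [set g.1; g.2] [set h.1; h.2]; case => _;
    rewrite d => /eqP ->; rewrite !(card_endpoints dG).
rewrite -setI_eq0; apply/eqP/setP => v; rewrite !inE; apply/negP =>
  /andP[] /orP[] /eqP -> /orP[] /eqP eqv.
- case/eqP: ne; apply: (slope_inj_left X_inj dG) => //.
  by move: eqt; rewrite /height /intercept eqv => eqt; apply: (@mulIf _ (t - X h.1)); lra.
- by move: g1 h2; rewrite eqv; lra.
- by move: g2 h1; rewrite eqv; lra.
- case/eqP: ne; apply: (slope_inj_right X_inj dG) => //.
  have [g12 _] := dG _ Gg; have [h12 _] := dG _ Gh.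
  have := height_right Y g12; have := height_right Y h12; move: eqt;
    rewrite /height eqv => eqt hr gr.
  by apply: (@mulIf _ (t - X h.2)); move: h2 eqt hr gr; rewrite -?eqv; lra.
Qed.

(** Average [drawing_card] over samples of density [1 / q]: vertices, edges and crossings survive
    with probabilities [1 / q], [1 / q ^ 2] and [1 / q ^ 4]. Then multiply by [q ^ 4]. *)
Lemma crossing_lemma G q : drawing X Y G -> (0 < q)%N ->
  (#|G| * q ^ 2 <= 3 * #|V| * q ^ 3 + #|crossings X Y G|)%N.
Proof.
case: q => // k dG _; set q := k.+1.
pose ends e := [set e.1; e.2] : {set V}.
pose ends2 (p : (V * V) * (V * V)) := ends p.1 :|: ends p.2.
have /(sum_card_zeros_superset k) SG : forall e, e \in G -> #|ends e| = 2%N.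
  by move=> e; exact: card_endpoints.
have /(sum_card_zeros_superset k) SC : forall p, p \in crossings X Y G ->
    #|ends2 p| = 4%N.
  by case=> g h; rewrite inE => /and3P[/= Gg Gh c];
    exact: (card_crossing_endpoints dG Gg Gh c).
have /(sum_card_zeros_superset k) SV : forall v : V, v \in [set: V] -> #|[set v]| = 1%N.
  by move=> v _; rewrite cards1.
have le : (\sum_(f : {ffun V -> 'I_k.+1}) #|[set e in G | ends e \subset zeros f]|
   <= \sum_(f : {ffun V -> 'I_k.+1}) (3 * #|[set v in [set: V] | [set v] \subset zeros f]|
        + #|[set p in crossings X Y G | ends2 p \subset zeros f]|))%N.
  apply: leq_sum => f _.
  have sE e : (ends e \subset zeros f) = (e.1 \in zeros f) && (e.2 \in zeros f).
    by rewrite finset.subUset !finset.sub1set.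
  apply: leq_trans (@drawing_card _ _ X Y X_inj _ (zeros f) _ _) _.
  - by move=> e; rewrite inE => /andP[/dG].
  - by move=> e; rewrite inE sE => /andP[_ /andP].
  apply: leq_add.
    rewrite leq_mul2l; apply/orP; right; apply/subset_leq_card/fintype.subsetP => v.
    by rewrite !inE finset.sub1set inE.
  apply/subset_leq_card/fintype.subsetP => -[g h].
  rewrite !inE /= => /and3P[/andP[-> sg] /andP[-> sh] ->] /=.
  by rewrite finset.subUset sg sh.
have Q0 : (0 < q ^ #|V|)%N by rewrite expn_gt0.
rewrite -(leq_pmul2r Q0).
move: le; rewrite big_split /= -big_distrr /=.
rewrite cardsT in SV; move: SG SC SV; rewrite -/q.
set a := (\sum_f _)%N; set b := (\sum_f _)%N; set c := (\sum_f _)%N;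
  set Q := (q ^ #|V|)%N.
move=> SG SC SV le; have := leq_mul le (leqnn (q ^ 4));
  rewrite (mulnDl (3 * c)) (mulnDl (3 * _ * _)) SC.
have -> : (a * q ^ 4 = #|G| * q ^ 2 * Q)%N by rewrite mulnAC -SG -mulnA -expnD.
suff -> : (3 * c * q ^ 4 = 3 * #|V| * q ^ 3 * Q)%N by [].
by rewrite -!(mulnA 3) (mulnAC #|V|) -SV -(mulnA c) -expnD.
Qed.

End CrossingLemma.

(** * The Szemeredi-Trotter bound for rich lines in the plane *)

Section RichLines.
Set Implicit Arguments.
Unset Strict Implicit.
Variables (R : realType) (V : finType) (X Y : V -> R).
Hypothesis X_inj : injective X.
Implicit Types (e g h : V * V) (S : {set V}) (m : nat).

Definition line_points e : {set V} := [set c | Y c == height X Y e (X c)].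

(** A line is encoded by its set of vertices, which identifies all pairs spanning the same line. *)
Definition rich_lines m : {set {set V}} :=
  [set line_points e | e in
    [set e : V * V | (X e.1 < X e.2) && (m <= #|line_points e|)%N]].

Definition rich_edges m : {set V * V} :=
  [set e | [&& X e.1 < X e.2, (m <= #|line_points e|)%N &
     [forall c in line_points e, ~~ (X e.1 < X c < X e.2)]]].

Lemma line_points_ends e : X e.1 < X e.2 ->
  e.1 \in line_points e /\ e.2 \in line_points e.
Proof. by move=> lt; rewrite !inE height_left height_right. Qed.

Lemma line_points_inj e g : X g.1 < X g.2 ->
    g.1 \in line_points e -> g.2 \in line_points e ->
  slope X Y g = slope X Y e /\ intercept X Y g = intercept X Y e.
Proof.
move=> lt; have := height_right Y lt; have := height_left X Y g.
rewrite !inE /height => h1 h2 /eqP e1 /eqP e2.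
have es : slope X Y g = slope X Y e by apply: (@mulIf _ (X g.2 - X g.1)); lra.
by split=> //; move: h1; rewrite e1 es; lra.
Qed.

Lemma line_points_eq e g : slope X Y g = slope X Y e ->
  intercept X Y g = intercept X Y e -> line_points g = line_points e.
Proof. by move=> es ei; apply/setP => c; rewrite !inE /height es ei. Qed.

Lemma drawing_rich_edges m : drawing X Y (rich_edges m).
Proof.
move=> e; rewrite inE => /and3P[lt _ /forall_inP no]; split=> // c btw /eqP Yc.
by move: (no c); rewrite inE Yc btw => /(_ isT).
Qed.

(** Every point of a rich line except the rightmost one, [z], starts an edge, which ends at the next
    point of the line. *)
Lemma card_rich_edges m : (#|rich_lines m| * m.-1 <= #|rich_edges m|)%N.
Proof.
rewrite -sum_nat_const -[X in (_ <= X)%N]sum1_card.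
rewrite [X in (_ <= X)%N](partition_big line_points (mem (rich_lines m))) /=; last first.
  by move=> e; rewrite inE => /and3P[lt me _]; apply: imset_f; rewrite inE lt.
apply: leq_sum => S /imsetP[e0]; rewrite inE => /andP[lt0 me0] ->.
rewrite sum1dep_card; set L := line_points e0.
have [L1 _] := line_points_ends lt0.
case: (@arg_maxP _ _ _ e0.1 (mem L) X L1) => z Lz maxz.
have : (m.-1 <= #|L :\ z|)%N.
  by rewrite -subn1 leq_subLR; apply: leq_trans me0 _;
    rewrite (cardsD1 z) leq_add2r leq_b1.
move/leq_trans; apply.
apply: (@leq_card_rel _ _ _ _ (fun a e => e.1 = a)); last first.
  by move=> a a' e _ _ <- <-.
move=> a; rewrite !inE => /andP[az La].
have Lla : a \in L by rewrite inE.
have Pz : (z \in L) && (X a < X z).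
  by rewrite (_ : z \in L = true) // lt_neqAle (inj_eq X_inj) az /=; exact: maxz.
case: (@arg_minP _ _ _ z (fun b => (b \in L) && (X a < X b)) X Pz) =>
  b /andP[Lb lab] minb.
exists (a, b) => //.
have [es ei] := @line_points_inj e0 (a, b) lab Lla Lb.
have eL : line_points (a, b) = L by exact: line_points_eq.
rewrite !inE /= lab eL me0 eqxx andbT /=.
apply/forall_inP => c Lc; apply/negP => /andP[ac cb].
by have := minb c; rewrite Lc ac => /(_ isT); lra.
Qed.

(** If the edges differed, an end of one would lie strictly inside the other, against
    consecutiveness. *)
Lemma rich_edge_overlap m e g t : e \in rich_edges m -> g \in rich_edges m ->
    line_points e = line_points g -> X e.1 < t < X e.2 -> X g.1 < t < X g.2 ->
  e = g.
Proof.
rewrite !inE => /and3P[e12 _ /forall_inP ne] /and3P[g12 _ /forall_inP ng] eL et gt.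
have [e1 e2] := line_points_ends e12; have [g1 g2] := line_points_ends g12.
rewrite -eL in g1 g2 ng.
have := ne _ g1; have := ne _ g2; have := ng _ e1; have := ng _ e2.
have [lt1|lt1|/X_inj eq1] := ltgtP (X e.1) (X g.1).
- by have -> : X g.1 < X e.2 by lra.
- by have -> : X e.1 < X g.2 by lra.
have [lt2|lt2|/X_inj eq2] := ltgtP (X e.2) (X g.2).
- by have -> : X g.1 < X e.2 by lra.
- by have -> : X e.1 < X g.2 by lra.
by rewrite (surjective_pairing e) eq1 eq2 -surjective_pairing.
Qed.

(** Two lines meet at most once, and on each line a single edge passes through the meeting point, so
    a crossing is determined by its ordered pair of lines. *)
Lemma card_rich_crossings m :
  (#|crossings X Y (rich_edges m)| <= #|rich_lines m| ^ 2)%N.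
Proof.
rewrite expnS expn1 -cardsX.
pose F (p : (V * V) * (V * V)) := (line_points p.1, line_points p.2).
have crE p : (p \in crossings X Y (rich_edges m)) =
    [&& p.1 \in rich_edges m, p.2 \in rich_edges m & crossing X Y p.1 p.2].
  by rewrite inE.
have inL e : e \in rich_edges m -> line_points e \in rich_lines m.
  by rewrite inE => /and3P[lt me _]; apply: imset_f; rewrite inE lt.
have same e g : e \in rich_edges m -> line_points e = line_points g -> X g.1 < X g.2 ->
    slope X Y g = slope X Y e /\ intercept X Y g = intercept X Y e.
  move=> _ eL lt; apply: line_points_inj => //; rewrite eL.
    exact: (line_points_ends lt).1.
  exact: (line_points_ends lt).2.
have Finj : {in crossings X Y (rich_edges m) &, injective F}.
  move=> [e g] [e' g']; rewrite !crE /=.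
  move=> /and3P[Ge Gg /andP[ne /asboolP[t [et1 et2 gt1 gt2 eqt]]]].
  move=> /and3P[Ge' Gg' /andP[_ /asboolP[t' [et1' et2' gt1' gt2' eqt']]]] [eLe eLg].
  have [lte' _] := drawing_rich_edges Ge'; have [ltg' _] := drawing_rich_edges Gg'.
  have [se ie] := same _ _ Ge eLe lte'; have [sg ig] := same _ _ Gg eLg ltg'.
  (* Agreement at two abscissas would make the lines of [e] and [g] equal, and then the overlapping
     [e] and [g] would coincide. *)
  have ett : t = t'.
    apply: contra_neq_eq ne => tt; apply: (@rich_edge_overlap m _ _ t);
      rewrite ?et1 ?gt1 //.
    have es : slope X Y e = slope X Y g.
      have tt' : t - t' != 0 by rewrite subr_eq0.
      by apply: (mulIf tt'); move: eqt eqt'; rewrite /height se ie sg ig; lra.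
    by apply: line_points_eq => //; move: eqt; rewrite /height es; lra.
  congr pair; apply: (@rich_edge_overlap m _ _ t); rewrite // ?et1 ?gt1 //.
    by rewrite ett et1'.
  by rewrite ett gt1'.
rewrite -(card_in_imset Finj); apply/subset_leq_card/fintype.subsetP =>
  _ /imsetP[[e g] + ->].
by rewrite crE => /and3P[/= Ge Gg _]; rewrite finset.in_setX !inL.
Qed.

(* The crossing lemma is applied with [q] about [L M / 6 n]. *)
Lemma crossing_arith (L M n : nat) : (0 < n)%N ->
    (forall q, (0 < q)%N -> (L * M * q ^ 2 <= 3 * n * q ^ 3 + L ^ 2)%N) ->
  (L * M < 6 * n)%N \/ (L * M ^ 3 <= 288 * n ^ 2)%N.
Proof.
move=> n0 H; have [q0|q_gt0] := posnP (L * M %/ (6 * n)).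
  by left; move/eqP: q0; rewrite -leqn0 leqNgt divn_gt0 ?muln_gt0 // -ltnNge.
right; move: (H _ q_gt0); set q := (_ %/ _)%N in q_gt0 *; rewrite !expnS !expn0 !muln1.
have lo : (q * (6 * n) <= L * M)%N by exact: leq_trunc_div.
have hi : (L * M < q.+1 * (6 * n))%N by rewrite -ltn_divLR //; lia.
have L0 : (0 < L)%N by case: (posnP L) hi lo => // ->; nia.
have [P hP] : exists P, P = (L * M)%N by exists (L * M)%N.
rewrite -hP in lo hi *.
move=> le.
(* By [lo] the term with [q ^ 3] is at most half of the left side and is absorbed. *)
have le2 : (P * (q * q) <= 2 * (L * L))%N.
  have := leq_mul lo (leqnn (q * q)); move: le; clear.
  have -> : (3 * n * (q * (q * q)) = 3 * (n * q * (q * q)))%N by lia.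
  have -> : (q * (6 * n) * (q * q) = 6 * (n * q * (q * q)))%N by lia.
  by lia.
have le3 : (M * (q * q) <= 2 * L)%N.
  by rewrite -(leq_pmul2l L0) mulnA -hP; move: le2; clear; lia.
have Pq : (P <= 12 * n * q)%N by move: hi q_gt0; clear; nia.
(* After multiplying by [L], squaring [Pq] gives the factor 144 and [le3] the factor 2, whence
   288. *)
rewrite -(leq_pmul2l L0).
have -> : (L * (L * (M * (M * M))) = P * P * M)%N by rewrite hP; lia.
apply: leq_trans (leq_mul (leq_mul Pq Pq) (leqnn M)) _.
have -> : (12 * n * q * (12 * n * q) * M = 144 * (n * n) * (M * (q * q)))%N by lia.
apply: leq_trans (leq_mul (leqnn _) le3) _.
by apply: eq_leq; lia.
Qed.

(** Since [m <= 2 * m.-1], passing from [m.-1] to [m] costs a factor 2 in the first alternative and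
    8 in the second: 12 = 2 * 6 and 2304 = 8 * 288. *)
Lemma card_rich_lines m : (1 < m)%N -> (0 < #|V|)%N ->
  (#|rich_lines m| * m <= 12 * #|V|)%N \/ (#|rich_lines m| * m ^ 3 <= 2304 * #|V| ^ 2)%N.
Proof.
move=> m1 V0; have [k mk] : exists k, m = k.+2 by exists m.-2; lia.
have := @crossing_arith #|rich_lines m| m.-1 #|V| V0 _; case.
- move=> q q0; apply: leq_trans (leq_mul (card_rich_edges m) (leqnn _)) _.
  apply: leq_trans (crossing_lemma X_inj (@drawing_rich_edges m) q0) _.
  by rewrite leq_add2l card_rich_crossings.
- move=> H; left; have : (m <= 2 * m.-1)%N by rewrite mk; lia.
  by move=> /(leq_mul (leqnn #|rich_lines m|)); lia.
move=> H; right; have : (m ^ 3 <= (2 * m.-1) ^ 3)%N by rewrite leq_exp2r // mk; lia.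
move=> /(leq_mul (leqnn #|rich_lines m|)) /leq_trans; apply.
by rewrite expnMn mulnCA; lia.
Qed.

End RichLines.

(** * Inner products, right angles and perpendicular feet *)

Section DotProduct.
Set Implicit Arguments.
Unset Strict Implicit.
Variables (R : realType) (d : nat).
Implicit Types (x y z p q : 'rV[R]_d) (a : R).

Lemma dotC x y : dot x y = dot y x.
Proof. by apply: eq_bigr => i _; rewrite mulrC. Qed.

Lemma dotDl x y z : dot (x + y) z = dot x z + dot y z.
Proof. by rewrite /dot -big_split; apply: eq_bigr => i _; rewrite mxE mulrDl. Qed.

Lemma dotZl a x y : dot (a *: x) y = a * dot x y.
Proof. by rewrite /dot big_distrr /=; apply: eq_bigr => i _; rewrite mxE mulrA. Qed.

Lemma dotBl x y z : dot (x - y) z = dot x z - dot y z.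
Proof. by rewrite -scaleN1r dotDl dotZl mulN1r. Qed.

Lemma dotBr x y z : dot z (x - y) = dot z x - dot z y.
Proof. by rewrite dotC dotBl !(dotC z). Qed.

Lemma dotZr a x y : dot x (a *: y) = a * dot x y.
Proof. by rewrite dotC dotZl dotC. Qed.

Lemma dot_ge0 x : 0 <= dot x x.
Proof. by apply: sumr_ge0 => i _; rewrite -expr2 sqr_ge0. Qed.

Lemma dot_eq0 x : (dot x x == 0) = (x == 0).
Proof.
apply/eqP/eqP => [|->]; last by rewrite /dot big1 // => i _; rewrite mxE mul0r.
move/psumr_eq0P => x0; apply/rowP => i; rewrite mxE; apply/eqP.
by rewrite -(sqrf_eq0 (x 0 i)) expr2 x0 // => j _; rewrite -expr2 sqr_ge0.
Qed.

Lemma dot_gt0 x : x != 0 -> 0 < dot x x.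
Proof. by move=> x0; rewrite lt_neqAle eq_sym dot_eq0 x0 dot_ge0. Qed.

(** Cauchy-Schwarz: [dot y y *: x - dot x y *: y] has squared norm [dot y y] times the difference of
    the two sides. *)
Lemma dot_sqr_le x y : y != 0 -> dot x y ^+ 2 <= dot x x * dot y y.
Proof.
move=> /dot_gt0 y0; have := dot_ge0 (dot y y *: x - dot x y *: y).
rewrite !(dotBl, dotBr, dotZl, dotZr) (dotC y x).
set a := dot x x; set b := dot y y in y0 *; set c := dot x y => h.
have : 0 <= b * (a * b - c ^+ 2) by apply: le_trans h _; lra.
by rewrite pmulr_rge0 // subr_ge0.
Qed.

Lemma right_angle_dot x y z : right_angle x y z -> dot (x - y) (z - y) = 0.
Proof.
move=> [xy yz]; rewrite /angle /enorm.
have u0 : x - y != 0 by rewrite subr_eq0.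
have v0 : z - y != 0 by rewrite subr_eq0 eq_sym.
set u := x - y in u0 *; set v := z - y in v0 *.
have nu : 0 < Num.sqrt (dot u u) by rewrite sqrtr_gt0 dot_gt0.
have nv : 0 < Num.sqrt (dot v v) by rewrite sqrtr_gt0 dot_gt0.
have den0 : 0 < Num.sqrt (dot u u) * Num.sqrt (dot v v) by rewrite mulr_gt0.
set r := dot u v / _ => acosr.
(* Only on this interval does [cos] undo [acos]; Cauchy-Schwarz places [r] there. *)
have r1 : r \in `[(-1), 1].
  rewrite in_itv /= -ler_norml -[leRHS](normr1 R) -ler_sqr ?nnegrE // ?normr1 //.
  rewrite -normrX ger0_norm ?sqr_ge0 // /r expr_div_n exprMn !sqr_sqrtr ?dot_ge0 //
    expr1n.
  by rewrite ler_pdivrMr ?mulr_gt0 ?dot_gt0 // mul1r dot_sqr_le.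
have : r = 0 by rewrite -(acosK r1) acosr cos_pihalf.
by move/eqP; rewrite /r mulf_eq0 invr_eq0 (gt_eqF den0) orbF => /eqP.
Qed.

(** With [p' = p + t *: (q - p)], both directions are proportional, and subtracting the two
    orthogonality relations leaves [t * dot (q - p) (q - p) = 0]. *)
Lemma foot_unique x p q p' q' : p' != q' -> line p q p' -> line p q q' ->
  dot (x - p) (q - p) = 0 -> dot (x - p') (q' - p') = 0 -> p = p'.
Proof.
move=> ne [t pE] [u qE]; rewrite {}qE {}pE in ne *.
have -> : p + u *: (q - p) - (p + t *: (q - p)) = (u - t) *: (q - p).
  by rewrite scalerBl opprD addrACA subrr add0r.
have ut : u - t != 0 by apply: contra ne; rewrite subr_eq0 => /eqP ->.
move=> xp; rewrite dotZr opprD addrA dotBl xp => /eqP;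
  rewrite mulf_eq0 (negPf ut) sub0r oppr_eq0 dotZl mulf_eq0 dot_eq0 /=.
by case/orP => /eqP ->; rewrite ?scale0r ?scaler0 addr0.
Qed.

End DotProduct.

(** * A generic projection from space to the plane *)

Section GenericProjection.
Set Implicit Arguments.
Unset Strict Implicit.
Variable R : realType.
Implicit Types (p q r : 'rV[R]_3) (s t : R) (E : {fset 'rV[R]_3}).

(** The product of the nonzero polynomials has fewer roots than its size, so one of the first
    [size P] naturals is not a root. *)
Lemma common_nonroot (I : finType) (F : I -> {poly R}) :
  exists s, forall i, F i != 0 -> ~~ root (F i) s.
Proof.
pose P := \prod_(i | F i != 0) F i.
have P0 : P != 0 by apply/prodf_neq0.
have [s Ps] : exists s, ~~ root P s.
  apply: contrapT => /forallNP all_root.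
  have := @max_poly_roots _ P [seq k%:R | k <- iota 0 (size P)] P0.
  rewrite size_map size_iota ltnn => H; suff: false by []; apply: H.
    by apply/allP => s _; apply/negPn/negP => /(all_root s).
  by rewrite map_inj_uniq ?iota_uniq // => a b /eqP; rewrite eqr_nat => /eqP.
exists s => i Fi; apply: contra Ps; rewrite /P (bigD1 i) //= rootM => ->.
by [].
Qed.

Let i1 : 'I_3 := lift ord0 ord0.
Let i2 : 'I_3 := lift ord0 (lift ord0 ord0).

(* The projection along the moment curve (1, s, s^2) and its tangent (0, 1, 2s):
   the normal (s^2, -2s, 1) of the image plane lies on no fixed plane for generic
   [s]. *)
Definition proj1 s p : R := p 0 ord0 + s * p 0 i1 + s ^+ 2 * p 0 i2.
Definition proj2 s p : R := p 0 i1 + 2 * s * p 0 i2.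

Lemma Poly3_eq0 (a b c : R) : Poly [:: a; b; c] = 0 -> [/\ a = 0, b = 0 & c = 0].
Proof.
move=> P0; have co i : [:: a; b; c]`_i = 0 by rewrite -coef_Poly P0 coef0.
by split; [exact: (co 0%N) | exact: (co 1%N) | exact: (co 2%N)].
Qed.

Lemma horner_Poly3 (a b c s : R) : (Poly [:: a; b; c]).[s] = a + b * s + c * s ^+ 2.
Proof. by rewrite horner_Poly /=; ring. Qed.

Lemma rowP3 p q : p 0 ord0 = q 0 ord0 -> p 0 i1 = q 0 i1 -> p 0 i2 = q 0 i2 -> p = q.
Proof.
move=> h0 h1 h2; apply/rowP => -[[|[|[|//]]] lt].
- by have -> : Ordinal lt = ord0 by exact: val_inj.
- by have -> : Ordinal lt = i1 by exact: val_inj.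
- by have -> : Ordinal lt = i2 by exact: val_inj.
Qed.

(** Coincidence of first coordinates and collinearity of the images are polynomial equations in [s].
    The coefficients of [P2] are, up to constants, the components of the cross product of [q - p]
    and [r - p], so [P2] vanishes identically only for collinear points; choose [s] off all roots of
    the nonzero polynomials. *)
Lemma generic_projection E : exists s,
  {in E &, injective (proj1 s)} /\
  forall p q r, p \in E -> q \in E -> r \in E -> p != q ->
    (proj1 s q - proj1 s p) * (proj2 s r - proj2 s p) =
      (proj2 s q - proj2 s p) * (proj1 s r - proj1 s p) -> line p q r.
Proof.
pose P1 p q := Poly [:: q 0 ord0 - p 0 ord0; q 0 i1 - p 0 i1; q 0 i2 - p 0 i2].
pose P2 p q r := let a := q - p in let b := r - p in
  Poly [:: a 0 ord0 * b 0 i1 - a 0 i1 * b 0 ord0;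
           - 2 * (a 0 i2 * b 0 ord0 - a 0 ord0 * b 0 i2);
           a 0 i1 * b 0 i2 - a 0 i2 * b 0 i1].
have [s hs] := @common_nonroot (bool * E * E * E)%type (fun i : bool * E * E * E =>
  let: (b, p, q, r) := i in if b then P1 (val p) (val q) else P2 (val p) (val q) (val r)).
have inj : {in E &, injective (proj1 s)}.
  move=> p q Ep Eq eqpq; have := hs (true, [` Ep]%fset, [` Eq]%fset, [` Ep]%fset) => /=.
  have [P0 _|_ /(_ isT)/negP[]] := eqVneq (P1 p q) 0.
    by have [h0 h1 h2] := Poly3_eq0 P0; apply: rowP3; lra.
  by rewrite /root horner_Poly3; move: eqpq; rewrite /proj1 => eqpq; apply/eqP; lra.
exists s; split=> // p q r Ep Eq Er pq eqD.
have := hs (false, [` Ep]%fset, [` Eq]%fset, [` Er]%fset) => /=.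
have [P0 _|_ /(_ isT)/negP[]] := eqVneq (P2 p q r) 0; last first.
  rewrite /root horner_Poly3 !mxE; move: eqD; rewrite /proj1 /proj2 => eqD; apply/eqP.
  by lra.
have [] := Poly3_eq0 P0; rewrite !mxE => h3 h2 h1.
have mul0 (x : R) k : x = 0 -> s ^+ k * x = 0 by move=> ->; rewrite mulr0.
have h1s := mul0 _ 1%N h1; have h2s := mul0 _ 1%N h2; have h3s := mul0 _ 1%N h3.
have h1ss := mul0 _ 2%N h1; have h2ss := mul0 _ 2%N h2; have h3ss := mul0 _ 2%N h3.
rewrite !expr1 in h1s h2s h3s.
have D0 : proj1 s q - proj1 s p != 0.
  by rewrite subr_eq0; apply: contra pq => /eqP eqp; apply/eqP/inj.
(* The parameter is read off the first projected coordinate; injectivity keeps the denominator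
   nonzero. *)
exists ((proj1 s r - proj1 s p) / (proj1 s q - proj1 s p)).
by apply: rowP3; rewrite !mxE; apply: (mulfI D0);
  rewrite mulrDr mulrA (mulrC (_ - _) (_ / _)) divfK //;
  rewrite /proj1; lra.
Qed.

End GenericProjection.

(** A tuple is sent to the projected line of [x2] and [x3] together with [x1] and [x4]. Collinearity
    of the images lifts to space, so [x2] and [x3] are recovered as feet on that line. *)
Lemma card_good_tuples (R : realType) (E : {fset 'rV[R]_3}) (m : nat) :
  exists X Y : E -> R, injective X /\
    (#|` good_tuples E m|%fset <= #|rich_lines X Y m| * (#|` E|%fset * #|` E|%fset))%N.
Proof.
have [s [inj col]] := generic_projection E.
pose X (x : E) := proj1 s (val x); pose Y (x : E) := proj2 s (val x).
exists X, Y.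
have X_inj : injective X by move=> x y /inj eqv; apply/val_inj/eqv; exact: valP.
split=> //.
have line3 S (x y z : E) : S \in rich_lines X Y m -> x \in S -> y \in S -> z \in S ->
    val x != val y -> line (val x) (val y) (val z).
  move=> /imsetP[e _ ->]; rewrite !inE => /eqP Yx /eqP Yy /eqP Yz xy.
  apply: col; rewrite ?(valP x) ?(valP y) ?(valP z) //.
  by move: Yx Yy Yz; rewrite /Y /X => -> -> ->; rewrite /height; ring.
have line2 e (x y z : E) : x \in line_points X Y e -> y \in line_points X Y e ->
    line (val x) (val y) (val z) -> z \in line_points X Y e.
  rewrite !inE => /eqP Yx /eqP Yy [t zE]; apply/eqP.
  move: Yx Yy; rewrite /Y /X zE /height /proj1 /proj2 !mxE => Yx Yy.
  set a := slope _ _ _ in Yx Yy *; set b := intercept _ _ _ in Yx Yy *.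
  have -> : (val x) 0 (lift ord0 ord0) + t * ((val y) 0 (lift ord0 ord0) - (val x) 0
    (lift ord0 ord0))
      + 2 * s * ((val x) 0 (lift ord0 (lift ord0 ord0)) +
      t * ((val y) 0 (lift ord0 (lift ord0 ord0)) - (val x) 0 (lift ord0 (lift ord0
        ord0))))
      = (1 - t) * (proj2 s (val x)) + t * proj2 s (val y) by rewrite /proj2; ring.
  by rewrite /proj2 Yx Yy; ring.
have cardE (K : choiceType) (A : {fset K}) : #|` A|%fset = #|[set: A]%SET| by rewrite
  cardsT cardfE.
rewrite !(cardE) -!cardsX.
apply: (@leq_card_rel _ _ _ _ (fun (a : good_tuples E m) (b : {set E} * (E * E)) =>
  let: (x1, x2, x3, x4) := val a in
  [/\ b.1 \in rich_lines X Y m, val b.2.1 = x1, val b.2.2 = x4 &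
    exists z2 z3 : E, [/\ val z2 = x2, val z3 = x3, z2 \in b.1 & z3 \in b.1]])).
- move=> [[[[x1 x2] x3] x4] /= good] _.
  have := good; rewrite !inE /= => /andP[/andP[/andP[/andP[E1 E2] E3] E4]] /asboolP.
  move=> [[x12 x23 _] _ rich _].
  pose z2 : E := [` E2]%fset; pose z3 : E := [` E3]%fset.
  have nX : X z2 != X z3 by apply: contra x23 => /eqP/X_inj/(congr1 val) /= ->.
  (* The pair is sorted because [rich_lines] is generated by pairs with the left point first. *)
  pose e := if X z2 < X z3 then (z2, z3) else (z3, z2).
  have e12 : X e.1 < X e.2.
    by rewrite /e; case: ifP => //= ge; rewrite lt_neqAle eq_sym nX leNgt ge.
  have [Le1 Le2] := @line_points_ends _ _ X Y e e12.
  have [L2 L3] : z2 \in line_points X Y e /\ z3 \in line_points X Y e.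
    by move: Le1 Le2; rewrite {2 4}/e; case: ifP => _ /=; split.
  have Srich : line_points X Y e \in rich_lines X Y m.
    apply: imset_f; rewrite inE e12; apply: leq_trans rich _; rewrite /npoints_on cardE.
    apply: (@leq_card_rel _ _ _ _ (fun a (b : E) => val b = val a)).
      move=> [p pin] _ /=; have := pin; rewrite !inE /= => /andP[Ep /set_mem lp].
      by exists [` Ep]%fset => //; apply: (line2 e z2 z3).
    by move=> a a' b _ _ e1 e2; apply: val_inj; rewrite -e1 -e2.
  exists (line_points X Y e, ([` E1]%fset, [` E4]%fset));
    first by rewrite !finset.in_setX Srich !finset.in_setT.
  by split=> //; exists z2, z3.
move=> [[[[x1 x2] x3] x4] /= good] [[[[x1' x2'] x3'] x4'] /= good'] [S [y1 y4]] _ _ /=.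
move=> [Sr q1 q4 [z2 [z3 [e2 e3 S2 S3]]]] [_ eq1 eq4 [z2' [z3' [e2' e3' S2' S3']]]].
apply: val_inj => /=; rewrite -q1 -q4 -eq1 -eq4.
have := good; have := good'; rewrite !inE /= =>
  /andP[_ /asboolP[r1' r2' _ _]] /andP[_ /asboolP[r1 r2 _ _]].
have [_ n23 _] := r1; have [_ n23' _] := r1'.
rewrite -q1 in r1; rewrite -q4 in r2; rewrite -eq1 in r1'; rewrite -eq4 in r2'.
have n32 : x3 != x2 by rewrite eq_sym.
have n32' : x3' != x2' by rewrite eq_sym.
rewrite -e2 -e3 in n23 n32 r1 r2 *; rewrite -e2' -e3' in n23' n32' r1' r2' *.
have -> : val z2 = val z2'.
  by apply: foot_unique (right_angle_dot r1) (right_angle_dot r1'); rewrite 1?eq_sym //;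
    apply: line3 Sr _ _ _ _.
(* Now the line is based at [x3] and directed towards [x2], so the inner products are swapped. *)
have -> : val z3 = val z3'.
  apply: (@foot_unique _ _ (val y4) _ (val z2) _ (val z2')) => //.
  - by apply: line3 Sr _ _ _ _.
  - by apply: line3 Sr _ _ _ _.
  - by rewrite dotC; exact: right_angle_dot.
  - by rewrite dotC; exact: right_angle_dot.
by [].
Qed.

Theorem theorem4p5 (R : realType) :
  exists (C : R) (N : nat), 0 < C /\
    forall (n m : nat) (E : {fset 'rV[R]_3}),
      #|` E|%fset = n -> (2 <= m)%N -> (N < n)%N ->
      #|` good_tuples E m|%fset%:R
        <= C * (n%:R ^+ 4 / m%:R ^+ 3 + n%:R ^+ 3 / m%:R).
Proof.
(* Naming the constant keeps the kernel from computing with the unary 2304. *)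
have [K KE] : exists K, K = 2304%N by exists 2304%N.
(* One constant serves both alternatives: 12 for the term [n ^ 3 / m] and 2304 for
   [n ^ 4 / m ^ 3]. *)
have K12 : 12 <= K%:R :> R by rewrite KE ler_nat.
exists K%:R, 0%N; split=> [|n m E En m2 n_gt0]; first by lra.
have [X [Y [X_inj le]]] := card_good_tuples E m.
have V0 : (0 < #|{: E}|)%N by rewrite -cardfE En.
have := card_rich_lines Y X_inj m2 V0; rewrite -KE.
move: le; rewrite -cardfE En; move: #|rich_lines X Y m| => L.
rewrite -(ler_nat R) !natrM => /le_trans trans bound; apply: trans.
have m0 : 0 < m%:R :> R by rewrite ltr0n; apply: leq_trans m2.
have term0 k l : 0 <= n%:R ^+ k / m%:R ^+ l :> R.
  by rewrite divr_ge0 ?exprn_ge0 ?ler0n.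
have := term0 4%N 3%N; have := term0 3%N 1%N; rewrite expr1 => t31 t43.
case: bound; rewrite -(ler_nat R) [leLHS]natrM [leRHS]natrM ?natrX.
- rewrite -ler_pdivlMr // => bound.
  have : L%:R * (n%:R * n%:R) <= 12 * (n%:R ^+ 3 / m%:R) :> R.
    apply: le_trans (ler_wpM2r _ bound) _; first by rewrite mulr_ge0 ?ler0n.
    by rewrite le_eqVlt; apply/orP; left; apply/eqP; ring.
  move=> /le_trans; apply; apply: le_trans (ler_wpM2r t31 K12) _.
  by rewrite mulrDr lerDr mulr_ge0 ?ler0n.
rewrite -ler_pdivlMr ?exprn_gt0 // => bound.
have : L%:R * (n%:R * n%:R) <= K%:R * (n%:R ^+ 4 / m%:R ^+ 3) :> R.
  apply: le_trans (ler_wpM2r _ bound) _; first by rewrite mulr_ge0 ?ler0n.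
  by rewrite le_eqVlt; apply/orP; left; apply/eqP; ring.
by rewrite mulrDr => /le_trans; apply; rewrite lerDl mulr_ge0 ?ler0n.
Qed.
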